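(* Let $T_3$ be the model completion of the theory of directed graphs with no directed cycle of length $\leq 3$. Then $\kappa_{\mathrm{shred}}(T_3) = \aleph_0$.
   Context: A directed graph is a set with an asymmetric irreflexive binary relation $R_1$. $T_3$ is the model completion of the theory, in the language $\{R_1\}$, of directed graphs with no directed cycle of length $\leq 3$ (i.e. there are no $z_0,z_1,z_2$ with $R_1(z_0,z_1)$, $R_1(z_1,z_2)$, $R_1(z_2,z_0)$), expanded by definitions by relations $S_1,S_2$, where $S_l(x,y)$ says that there is no directed $R_1$-path of positive length $\leq l$ from $x$ to $y$. In $T_3$, $\neg S_1(x,y)$ is equivalent to $R_1(x,y)$, and $\neg S_2(x,y)$ is equivalent to $x \neq y \wedge \neg R_1(y,x)$; so $T_3$ has quantifier elimination already in the language $\{R_1\}$. For a complete first-order theory $T$ with monster model $\mathbb{M}$, sets of parameters are small subsets of $\mathbb{M}$, models are small elementary submodels of $\mathbb{M}$, and $|T|$ is the (infinite) number of formulas of the language of $T$. Indiscernible sequences are sequences of tuples of a common length. Shredding. Let $A$ be a set of parameters and $\lambda$ an infinite cardinal. A formula $\varphi(x;a)$ (with parameters $a$) $\lambda$-shreds over $A$ if there is a sequence $\overline{b} = \langle b_{\alpha} : \alpha < \lambda\rangle$ which is indiscernible over $A$ and such that for no $\alpha < \lambda$ and $c \in \varphi(\mathbb{M};a)$ is $\overline{b}_{\geq \alpha} = \langle b_\beta : \alpha \le \beta < \lambda\rangle$ indiscernible over $Ac$. A type $\lambda$-shreds over $A$ if it implies a formula that $\lambda$-shreds over $A$. A type $p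 \in S(B)$ $\lambda$-shreds over $A$ with a built-in witness if $A \subseteq B$ and an indiscernible sequence witnessing the $\lambda$-shredding is contained in $B$. When $\lambda$ is omitted, $\lambda = (|T|+|A|)^{+}$. For $m<\omega$, $\kappa^{m}_{\mathrm{shred}}(T)$ is the minimal (infinite) regular cardinal $\kappa$ such that there is no increasing continuous sequence of models $\langle M_i : i \leq \kappa\rangle$ (continuous: $M_\delta = \bigcup_{i<\delta} M_i$ for limit $\delta$) and $p \in S^{m}(M_\kappa)$ such that for all $i<\kappa$, $p \upharpoonright M_{i+1}$ shreds over $M_i$ with a built-in witness; if no such cardinal exists, $\kappa^{m}_{\mathrm{shred}}(T) = \infty$. Set $\kappa_{\mathrm{shred}}(T) = \sup_m \kappa^{m}_{\mathrm{shred}}(T)$. *)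

(* Defs.v *)
From HB Require Import structures.
From mathcomp Require Import all_boot all_order.
From mathcomp Require Import boolp classical_sets functions cardinality.

Set Implicit Arguments.
Unset Strict Implicit.
Unset Printing Implicit Defensive.

Import Order.TTheory.
Local Open Scope classical_set_scope.
Local Open Scope card_scope.

(* A cardinal is an initial ordinal, given as a well-ordered type none of whose
   proper initial segments is as large as the whole; this also makes cardinals
   usable as index sets of transfinite sequences. *)
Record cardinal := Cardinal {
  card_disp : Order.disp_t;
  card_sort :> orderType card_disp;
  card_wf : well_founded (fun x y : card_sort => (x < y)%O);
  card_initial :
    forall x : card_sort, ~ ([set: card_sort] #<= [set y | (y < x)%O]) }.

Lemma nat_wf : well_founded (fun x y : nat => (x < y)%O).
Proof. by elim/ltn_ind => n IHn; constructor => m; exact: IHn. Qed.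

Lemma nat_initial (n : nat) : ~ ([set: nat] #<= [set m : nat | (m < n)%O]).
Proof. by apply/infiniteP => fin; apply: fin; apply: finite_II. Qed.

Definition aleph0 : cardinal := Cardinal nat_wf nat_initial.

Definition infinite_regular (K : cardinal) : Prop :=
  infinite_set [set: K] /\
  forall C : set K, (forall x, exists2 y, C y & (x <= y)%O) -> [set: K] #<= C.

(* [K] is the least cardinal greater than |X| *)
Definition card_successor (T : Type) (X : set T) (K : cardinal) : Prop :=
  ~ ([set: K] #<= X) /\
  forall K' : cardinal, ~ ([set: K'] #<= X) -> [set: K] #<= [set: K'].

(* None stands for the value infinity. *)
Definition ecardinal := option cardinal.

Definition ecard_le (k l : ecardinal) : Prop :=
  match k, l with
  | _, None => True
  | None, Some _ => False
  | Some K, Some K' => [set: K] #<= [set: K']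
  end.

Definition is_ecard_sup (S : ecardinal -> Prop) (k : ecardinal) : Prop :=
  (forall l, S l -> ecard_le l k) /\
  forall k', (forall l, S l -> ecard_le l k') -> ecard_le k k'.

Definition ord_succ (K : cardinal) (i j : K) : Prop :=
  (i < j)%O /\ forall k : K, ~~ (i < k < j)%O.

Definition ord_limit (K : cardinal) (d : K) : Prop :=
  (exists i : K, (i < d)%O) /\
  forall i : K, (i < d)%O -> exists j : K, (i < j < d)%O.

Record language := Language { symbol :> Type; arity : symbol -> nat }.

(* [formula L V] is the type of formulas with free variables among [V]; under
   a quantifier the variables are [option V], with [None] the bound one. *)
Inductive formula (L : language) (V : Type) : Type :=
| Bot
| Eq of V & V
| Rel (r : L) of (arity r).-tuple V
| Imp of formula L V & formula L V
| All of formula L (option V).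

Arguments Bot {L V}.
Arguments Eq {L V}.
Arguments Rel {L V}.
Arguments Imp {L V}.
Arguments All {L V}.

Definition Not L (V : Type) (f : formula L V) := Imp f Bot.

Record structure (L : language) := Structure {
  carrier :> Type;
  interp : forall r : L, (arity r).-tuple carrier -> Prop }.

Fixpoint sat L (M : structure L) (V : Type) (f : formula L V) : (V -> M) -> Prop :=
  match f in formula _ _ return (V -> M) -> Prop with
  | Bot => fun=> False
  | Eq x y => fun v => v x = v y
  | Rel r t => fun v => interp (map_tuple v t)
  | Imp g h => fun v => sat g v -> sat h v
  | All g => fun v => forall a : M, sat g (oapp v a)
  end.

Definition theory (L : language) := set (formula L void).

Definition models L (M : structure L) (T : theory L) : Prop :=
  inhabited M /\ forall s, T s -> sat s (of_void M).

Definition embedding L (M N : structure L) (f : M -> N) : Prop :=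
  injective f /\
  forall (r : L) (t : (arity r).-tuple M), interp t <-> interp (map_tuple f t).

(* [T'] together with the diagram of [M] is a complete theory: its models are
   the models of [T'] with an embedding of [M], and its sentences are the
   formulas evaluated at elements of [M]. *)
Definition diagram_complete L (T' : theory L) (M : structure L) : Prop :=
  forall n (f : formula L 'I_n) (v : 'I_n -> M),
    (forall (N : structure L) (e : M -> N),
       models N T' -> embedding e -> sat f (e \o v)) \/
    (forall (N : structure L) (e : M -> N),
       models N T' -> embedding e -> ~ sat f (e \o v)).

Definition model_completion L (T' T : theory L) : Prop :=
  [/\ forall M : structure L, models M T' -> models M T,
      forall M : structure L, models M T ->
        exists N : structure L, models N T' /\ exists e : M -> N, embedding e
    & forall M : structure L, models M T -> diagram_complete T' M].

Definition substructure L (M : structure L) (A : set M) : structure L :=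
  @Structure L A (fun r t => interp (map_tuple val t)).

Definition elementary_sub L (M : structure L) (A : set M) : Prop :=
  forall n (f : formula L 'I_n) (v : 'I_n -> substructure A),
    sat f v <-> sat f (fun i => val (v i) : M).

(* phi(x; a) with the variables x indexed by [X] and a finite tuple a. *)
Record pformula L (M : structure L) (X : Type) := PFormula {
  pf_arity : nat;
  pf_body : formula L (X + 'I_pf_arity);
  pf_param : 'I_pf_arity -> M }.

Arguments pf_param {L M X} p i : rename.

Section Types.
Variables (L : language) (M : structure L) (X : Type).

Definition holds (f : pformula M X) (c : X -> M) : Prop :=
  sat (pf_body f)
      (fun z => match z with inl x => c x | inr i => pf_param f i end).

Definition pnot (f : pformula M X) : pformula M X :=
  PFormula (Not (pf_body f)) (pf_param f).

Definition over (B : set M) : set (pformula M X) :=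
  [set f | forall i, B (pf_param f i)].

Definition realizes (p : set (pformula M X)) (c : X -> M) : Prop :=
  forall f, p f -> holds f c.

Definition complete_type (B : set M) (p : set (pformula M X)) : Prop :=
  [/\ p `<=` over B,
      forall q, q `<=` p -> finite_set q -> exists c, realizes q c
    & forall f, over B f -> p f \/ p (pnot f)].

Definition restrict (B : set M) (p : set (pformula M X)) := p `&` over B.

(* semantic implication inside [M], to be used in a monster model *)
Definition type_implies (p : set (pformula M X)) (f : pformula M X) : Prop :=
  forall c, realizes p c -> holds f c.

End Types.

Definition small (K : cardinal) (T : Type) (A : set T) : Prop := ~ ([set: K] #<= A).

Definition saturated (K : cardinal) L (M : structure L) : Prop :=
  forall (n : nat) (A : set M) (p : set (pformula M 'I_n)),
    small K A -> complete_type A p -> exists c, realizes p c.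

Definition strongly_homogeneous (K : cardinal) L (M : structure L) : Prop :=
  forall (A : set M) (f : M -> M), small K A ->
    (forall n (g : formula L 'I_n) (v : 'I_n -> M),
       (forall i, A (v i)) -> (sat g v <-> sat g (f \o v))) ->
    exists s : M -> M,
      [/\ bijective s, embedding s & forall x, A x -> s x = f x].

Definition strong_limit (K : cardinal) : Prop :=
  forall A : set K, small K A -> small K [set Y : set K | Y `<=` A].

(* the set of all formulas of [L], whose cardinal is |T| *)
Definition formulas (L : language) : set (formula L nat) := setT.
Arguments formulas L : clear implicits.

(* Small means of cardinal less than [mon_card]; it is a strong limit so that
   successors of small cardinals are small. *)
Record monster L (T : theory L) := Monster {
  mon_card : cardinal;
  mon_str :> structure L;
  mon_models : models mon_str T;
  mon_limit : strong_limit mon_card;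
  mon_formulas : small mon_card (formulas L);
  mon_saturated : saturated mon_card mon_str;
  mon_homogeneous : strongly_homogeneous mon_card mon_str }.

Definition small_model L (T : theory L) (MM : monster T) (A : set MM) : Prop :=
  small (mon_card MM) A /\ elementary_sub A.

(* The subsequence of [b] with indices in [D] is indiscernible over [A]. The
   tuples of [b] are indexed by a type [J], not necessarily finite. *)
Definition indiscernible L (M : structure L) (I : cardinal) (J : Type)
    (D : set I) (A : set M) (b : I -> J -> M) : Prop :=
  forall n (s t : 'I_n -> I) (f : pformula M ('I_n * J)),
    over A f ->
    (forall i, D (s i)) -> (forall i, D (t i)) ->
    {homo s : i j / (i < j)%O} -> {homo t : i j / (i < j)%O} ->
    (holds f (fun z => b (s z.1) z.2) <-> holds f (fun z => b (t z.1) z.2)).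

Definition shredding_witness L (M : structure L) (I : cardinal) m (A : set M)
    (f : pformula M 'I_m) (J : Type) (b : I -> J -> M) : Prop :=
  indiscernible setT A b /\
  forall (a : I) (c : 'I_m -> M), holds f c ->
    ~ indiscernible [set i | (a <= i)%O] (A `|` range c) b.

(* The length (|T| + |A|)^+ is described through the disjoint sum. *)
Definition shreds_built_in L (T : theory L) (MM : monster T) m
    (A B : set MM) (p : set (pformula MM 'I_m)) : Prop :=
  A `<=` B /\
  exists I : cardinal,
    card_successor [set: formulas L + A] I /\
    exists f : pformula MM 'I_m, type_implies p f /\
    exists (J : Type) (b : I -> J -> MM),
      [/\ small (mon_card MM) [set: J],
          forall i j, B (b i j)
        & shredding_witness A f b].

(* The sequence <M_i : i <= K> is given by [N] for i < K, and [NK] for i = K. *)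
Definition shred_chain L (T : theory L) (m : nat) (K : cardinal) : Prop :=
  exists (MM : monster T) (N : K -> set MM) (NK : set MM)
         (p : set (pformula MM 'I_m)),
    [/\ (forall i, small_model (N i)) /\ small_model NK,
        forall i j : K, (i <= j)%O -> N i `<=` N j,
        (forall d : K, ord_limit d -> N d = \bigcup_(i in [set i | (i < d)%O]) N i)
        /\ NK = \bigcup_i N i,
        complete_type NK p
      & forall i j : K, ord_succ i j ->
          shreds_built_in (N i) (N j) (restrict (N j) p)].

Definition is_kappa_shred_m L (T : theory L) (m : nat) (k : ecardinal) : Prop :=
  match k with
  | Some K =>
      [/\ infinite_regular K, ~ shred_chain T m K
        & forall K' : cardinal, infinite_regular K' -> ~ shred_chain T m K' ->
            [set: K] #<= [set: K']]
  | None => forall K : cardinal, infinite_regular K -> shred_chain T m K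
  end.

Definition is_kappa_shred L (T : theory L) (k : ecardinal) : Prop :=
  is_ecard_sup (fun l => exists m, is_kappa_shred_m T m l) k.

Definition digraph_language : language := @Language unit (fun=> 2).

Definition edge (M : structure digraph_language) (x y : M) : Prop :=
  @interp _ M tt [tuple x; y].

Definition Edge (V : Type) (x y : V) : formula digraph_language V :=
  @Rel digraph_language V tt [tuple x; y].

Definition ax_irreflexive : formula digraph_language void :=
  All (Not (Edge None None)).

Definition ax_asymmetric : formula digraph_language void :=
  All (All (Imp (Edge (Some None) None) (Not (Edge None (Some None))))).

Definition ax_no_3cycle : formula digraph_language void :=
  All (All (All
    (Imp (Edge (Some (Some None)) (Some None))
    (Imp (Edge (Some None) None)
         (Not (Edge None (Some (Some None)))))))).

Definition digraph3 : theory digraph_language :=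
  [set s | [\/ s = ax_irreflexive, s = ax_asymmetric | s = ax_no_3cycle]].

Lemma map_tuple2 (T U : Type) (f : T -> U) (x y : T) :
  map_tuple f [tuple x; y] = [tuple f x; f y].
Proof. exact: val_inj. Qed.

Lemma models_digraph3 (M : structure digraph_language) :
  models M digraph3 <->
  [/\ inhabited M,
      forall x : M, ~ edge x x,
      forall x y : M, edge x y -> ~ edge y x
    & forall x y z : M, edge x y -> edge y z -> ~ edge z x].
Proof.
split=> [[M0 ax]|[M0 irr asy cyc]].
  split=> //.
  - by move=> x; have /(_ x) := ax _ (Or31 _ _ erefl); rewrite /= !map_tuple2.
  - by move=> x y; have /(_ x y) := ax _ (Or32 _ _ erefl); rewrite /= !map_tuple2.
  - by move=> x y z; have /(_ x y z) := ax _ (Or33 _ _ erefl); rewrite /= !map_tuple2.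
split=> // s [] ->.
- by move=> x; have := irr x; rewrite /= !map_tuple2.
- by move=> x y; have := asy x y; rewrite /= !map_tuple2.
- by move=> x y z; have := cyc x y z; rewrite /= !map_tuple2.
Qed.

(* Main.v *)
(* Digraphs without directed cycles of length <= 3 have free amalgamation. If
   [p] restricted to [M_{i+1}] implies [f(x; a)], realize it by a tuple whose
   coordinates outside [M_{i+1}] avoid [a], then replace these coordinates by new
   ones with the same edges to [M_i] and [a] and no other edge: by quantifier
   elimination [f] still holds. An indiscernible sequence in [M_{i+1}] can only
   meet the finite tuple [a] eventually in constant coordinates, so a tail of it
   is indiscernible over [M_i] and the new tuple, unless some coordinate of [p] is
   an element of [M_{i+1}] outside [M_i]; this happens for finitely many [i]. *)
From mathcomp Require Import all_boot all_order.
From mathcomp Require Import boolp classical_sets functions cardinality.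
Require Import Defs.

Set Implicit Arguments.
Unset Strict Implicit.
Unset Printing Implicit Defensive.

Import Order.TTheory.
Local Open Scope classical_set_scope.
Local Open Scope card_scope.

(** * Cardinality: finitely many new points keep a set small *)

Lemma card_leTE (K T : Type) (A : set T) :
  ([set: K] #<= A) <-> exists f : K -> T, injective f /\ forall x, A (f x).
Proof.
split=> [/card_leP[f]|[f [fI fA]]].
  have inT (x : K) : x \in [set: K] by rewrite in_setT.
  exists (fun x => val (f (exist _ x (inT x)))); split=> [x y xy|x].
    have := @inj _ _ _ f (exist _ x (inT x)) (exist _ y (inT y)).
    rewrite !in_setT => /(_ isT isT) fI.
    by have /(congr1 val) := fI (val_inj xy).
  exact: set_mem (valP (f (exist _ x (inT x)))).
apply: (@card_le_trans _ _ _ (range f)).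
  by have := @inj_card_eq _ _ setT f (in2W fI); rewrite card_eq_le => /andP[].
by apply: subset_card_le => _ [x _ <-]; exact: fA.
Qed.

(** Hilbert's hotel: [s] shifts along a sequence [g] avoiding [k0], sends [k0] to the freed place
    [g 0] and fixes all other points. *)
Lemma infinite_setD1_inj (K : Type) (k0 : K) : infinite_set [set: K] ->
  exists s : K -> K, injective s /\ forall k, s k <> k0.
Proof.
move=> Kinf.
have [g [gI gk0]] : exists g : nat -> K, injective g /\ forall n, g n <> k0.
  apply: (iffLR (card_leTE nat [set k | k <> k0])); apply/infiniteP.
  have -> : [set k | k <> k0] = [set: K] `\` [set k0].
    by apply/seteqP; split=> k //= [].
  by apply: infinite_setD => //; exact: finite_set1.
pose s k := if pselect (k = k0) then g 0
  else if pselect (exists n, g n = k) is left e then g (projT1 (cid e)).+1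
  else k.
exists s; split=> [x y|k]; rewrite /s; last first.
  case: pselect => [e|kk0]; first exact: gk0.
  by case: pselect => [e|//]; exact: gk0.
case: (pselect (x = k0)) => [xk0|xk0]; case: (pselect (y = k0)) => [yk0|yk0].
- by move=> _; rewrite xk0 yk0.
- by case: (pselect (exists n, g n = y)) => e /=; [move/gI|move=> ge; case: e; exists 0].
- by case: (pselect (exists n, g n = x)) => e /=; [move/gI|move=> ge; case: e; exists 0].
- case: (pselect (exists n, g n = x)) => e;
    case: (pselect (exists n, g n = y)) => e' //=.
  + by move/gI => [n]; case: (cid e) (cid e') n => [n gn] [n' gn'] /= nn'; rewrite -gn -gn' nn'.
  + by move=> ge; case: e'; exists (projT1 (cid e)).+1.
  + by move=> ge; case: e; exists (projT1 (cid e')).+1.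
Qed.

Lemma smallU1 (K : cardinal) (T : Type) (A : set T) (x : T) :
  infinite_set [set: K] -> small K A -> small K (A `|` [set x]).
Proof.
move=> Kinf smA /card_leTE[f [fI fAx]]; apply: smA; apply/card_leTE.
have [[k0 k0x]|nox] := pselect (exists k, f k = x).
  have [s [sI sk0]] := infinite_setD1_inj k0 Kinf.
  exists (f \o s); split=> [|k]; first exact: inj_comp.
  by have [//|/= fx] := fAx (s k); case: (sk0 k); apply: fI; rewrite k0x.
exists f; split=> // k.
by have [//|fx] := fAx k; case: nox; exists k.
Qed.

Lemma smallU_range (K : cardinal) (T : Type) (A : set T) n (a : 'I_n -> T) :
  infinite_set [set: K] -> small K A -> small K (A `|` range a).
Proof.
move=> Kinf smA; elim: n a => [|n IHn] a.
  suff -> : range a = set0 by rewrite setU0.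
  by apply/seteqP; split=> // x [[]].
suff -> : A `|` range a =
    (A `|` range (a \o lift ord_max)) `|` [set a ord_max].
  exact: smallU1.
apply/seteqP; split=> [x [Ax|[i _ <-]]|x [[Ax|[i _ <-]]|->]].
- by left; left.
- case: (unliftP ord_max i) => [j ->|->]; last by right.
  by left; right; exists j.
- by left.
- by right; exists (lift ord_max i).
- by right; exists ord_max.
Qed.

(** * Syntax: renaming, finite support, existential quantifiers *)

Section Formulas.
Variable L : language.

Fixpoint rename (V W : Type) (r : V -> W) (f : formula L V) : formula L W :=
  match f with
  | Bot => Bot
  | Eq x y => Eq (r x) (r y)
  | Rel s t => Rel s (map_tuple r t)
  | Imp g h => Imp (rename r g) (rename r h)
  | All g => All (rename (omap r) g)
  end.

Lemma map_tuple_comp (T U W : Type) n (g : U -> W) (f : T -> U) (t : n.-tuple T) :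
  map_tuple g (map_tuple f t) = map_tuple (g \o f) t.
Proof. by apply: val_inj; rewrite /= -map_comp. Qed.

Lemma sat_rename (M : structure L) (V W : Type) (r : V -> W) (f : formula L V)
    (v : W -> M) :
  sat (rename r f) v <-> sat f (v \o r).
Proof.
elim: f W r v => {V} [V|V x y|V s t|V g IHg h IHh|V g IHg] W r v //=.
- by rewrite map_tuple_comp.
- by split=> H /IHg/H/IHh.
- suff vE a : oapp v a \o omap r = oapp (v \o r) a.
    by split=> H a; have := H a; [move/IHg; rewrite vE|move=> ?; apply/IHg; rewrite vE].
  by apply/funext => -[].
Qed.

(** This reduces formulas over any type of variables to the ['I_n] of [diagram_complete]. [None]
    marks positions captured by a quantifier; their value [a] is a dummy. *)
Lemma finite_support (V : Type) (f : formula L V) :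
  exists n (g : formula L 'I_n) (r : 'I_n -> option V),
    forall (M : structure L) (v : V -> M) (a : M),
      sat f v <-> sat g (oapp v a \o r).
Proof.
elim: f => {V} [V|V x y|V s t|V g [n [g' [r gE]]] h [n' [h' [r' hE]]]|
                V g [n [g' [r gE]]]].
- by exists 0, Bot, (fun=> None).
- exists 2, (Eq ord0 ord_max), (fun i => Some (if i == ord0 then x else y)).
  by [].
- exists (arity s), (Rel s (ord_tuple _)), (fun i => Some (tnth t i)) => M v a /=.
  suff -> : map_tuple v t = map_tuple (oapp v a \o (fun i => Some (tnth t i)))
                                   (ord_tuple (arity s)) by [].
  by apply: eq_from_tnth => i; rewrite !tnth_map /= tnth_ord_tuple.
- exists (n + n'), (Imp (rename (lshift n') g') (rename (@rshift n n') h')),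
    (fun i => match fintype.split i with inl j => r j | inr j => r' j end) => M v a /=.
  rewrite (gE M v a) (hE M v a) !sat_rename.
  set w := (X in _ <-> (sat _ (X \o _) -> _)).
  have -> : oapp v a \o r = w \o lshift n'.
    by apply/funext => i; rewrite /w /= (unsplitK (inl i)).
  have -> // : oapp v a \o r' = w \o (@rshift n n').
  by apply/funext => i; rewrite /w /= (unsplitK (inr i)).
- exists n, (All (rename (fun i => if r i is Some None then None else Some i) g')),
    (fun i => if r i is Some (Some x) then Some x else None) => M v a /=.
  split=> H b; have := H b.
    move/(gE M _ a) => H1; apply/sat_rename; move: H1; congr sat.
    by apply/funext => i /=; case E: (r i) => [[x|]|] //=; rewrite E.
  move/sat_rename=> H1; apply/(gE M _ a); move: H1; congr sat.
  by apply/funext => i /=; case E: (r i) => [[x|]|] //=; rewrite E.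
Qed.

(** Needed to state in one formula that finitely many conditions have a common solution. *)
Lemma exists_formula (V : Type) m (f : formula L ('I_m + V)) :
  exists g : formula L V, forall (M : structure L) (v : V -> M),
    sat g v <-> exists c : 'I_m -> M,
      sat f (fun z => match z with inl i => c i | inr x => v x end).
Proof.
elim: m f => [|m IHm] f.
  exists (rename (fun z : 'I_0 + V => match z with
    | inl i => False_rect V (notF (ltn_ord i)) | inr x => x end) f) => M v.
  rewrite sat_rename; split=> [H|[c]].
    exists (fun i : 'I_0 => False_rect M (notF (ltn_ord i))).
    by move: H; congr sat; apply/funext => -[[]|].
  by congr sat; apply/funext => -[[]|].
pose r (z : 'I_m.+1 + V) : option ('I_m + V) := match z with
  | inl i => if unlift ord0 i is Some j then Some (inl j) else None
  | inr x => Some (inr x) end.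
have [g gE] := IHm (Not (All (Not (rename r f)))).
exists g => M v; rewrite gE /=; split=> [[c H]|[c fc]].
  apply: contrapT => Hn; apply: H => a /sat_rename fa; apply: Hn.
  exists (fun i => if unlift ord0 i is Some j then c j else a).
  move: fa; congr sat; apply/funext => -[i|//] /=.
  by case: (unlift ord0 i).
exists (c \o lift ord0) => /(_ (c ord0)); apply; apply/sat_rename.
move: fc; congr sat; apply/funext => -[i|//] /=.
by case: (unliftP ord0 i) => [j ->|->].
Qed.

End Formulas.

(** * Digraph embeddings and quantifier elimination *)

Lemma digraph_embeddingP (M N : structure digraph_language) (e : M -> N) :
  embedding e <->
  injective e /\ forall x y, edge x y <-> edge (e x) (e y).
Proof.
split=> -[eI eE]; split=> //.
  by move=> x y; rewrite /edge -(map_tuple2 e); exact: eE.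
case=> t; have [x [y ->]] : exists x y, t = [tuple x; y].
  case: t => -[|x [|y []]] //= s2; exists x, y; exact: val_inj.
by rewrite map_tuple2; exact: eE.
Qed.

(** Each axiom forbids a directed cycle, and a homomorphism would carry such a cycle into [N]. *)
Lemma models_pullback (M N : structure digraph_language) (h : M -> N) :
  (forall x y, edge x y -> edge (h x) (h y)) -> inhabited M ->
  models N digraph3 -> models M digraph3.
Proof.
move=> hE M0 /models_digraph3[_ irr asy cyc]; apply/models_digraph3; split=> //.
- by move=> x /hE/irr.
- by move=> x y /hE xy /hE; exact: asy.
- by move=> x y z /hE xy /hE yz /hE; exact: cyc yz.
Qed.

Section ModelCompletion.
Variables (T : theory digraph_language) (hT : model_completion T digraph3).

(** Completeness of the diagram of [M] decides a formula at a finite tuple of [M] alike in all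
    models of [T] that extend [M]. *)
Lemma sat_embeddings (M N N' : structure digraph_language)
    (e : M -> N) (e' : M -> N') (V : Type) (f : formula digraph_language V)
    (v : V -> M) :
  models M digraph3 -> models N T -> models N' T -> embedding e -> embedding e' ->
  sat f (e \o v) <-> sat f (e' \o v).
Proof.
move=> hM hN hN' he he'; have [_ _ dc] := hT.
have [n [g [r gE]]] := finite_support f.
have [[x0]] := (models_digraph3 M).1 hM.
rewrite (gE _ _ (e x0)) (gE _ _ (e' x0)) => _ _ _.
have E (N0 : structure digraph_language) (e0 : M -> N0) :
    oapp (e0 \o v) (e0 x0) \o r = e0 \o (oapp v x0 \o r).
  by apply/funext => i /=; case: (r i).
rewrite (E N e) (E N' e').
have [H|H] := dc _ hM _ g (oapp v x0 \o r).
  by split=> _; exact: H.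
by split=> [/(H _ _ hN he)|/(H _ _ hN' he')].
Qed.

Lemma models_completion (M : structure digraph_language) :
  models M T -> models M digraph3.
Proof. by case: hT => + _ _; exact. Qed.

Lemma sat_embedding (M N : structure digraph_language) (e : M -> N) (V : Type)
    (f : formula digraph_language V) (v : V -> M) :
  models M T -> models N T -> embedding e -> sat f v <-> sat f (e \o v).
Proof.
move=> hM hN he.
apply: (@sat_embeddings M M N id) => //; first exact: models_completion.
by apply/digraph_embeddingP; split.
Qed.

(** The digraph on the range of [v] has two embeddings into [M]: the inclusion, and the map taking
    [v x] to [w x]. *)
Lemma quantifier_elimination (M : structure digraph_language) (V : Type)
    (f : formula digraph_language V) (v w : V -> M) :
  models M T ->
  (forall x y, v x = v y <-> w x = w y) ->
  (forall x y, edge (v x) (v y) <-> edge (w x) (w y)) ->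
  sat f v <-> sat f w.
Proof.
move=> hM eqE edgeE.
have [[x0]|noV] := pselect (inhabited V); last first.
  by suff -> : v = w by []; apply/funext => x; case: noV.
have vr x : range v (v x) by exists x.
pose M0 := substructure (range v).
pose e1 : M0 -> M := val.
pose pre (x : M0) : V := projT1 (cid2 (set_mem (valP x))).
have preK x : v (pre x) = e1 x by rewrite /pre; case: (cid2 _).
have e1I : injective e1 by case=> x ? [y ?]; exact: eq_exist.
pose e2 : M0 -> M := w \o pre.
pose v0 x : M0 := exist _ (v x) (mem_set (vr x)).
have -> : v = e1 \o v0 by [].
have -> : w = e2 \o v0.
  by apply/funext => x /=; apply/eqE; rewrite preK.
have edgeM0 (x y : M0) : edge x y <-> edge (e1 x) (e1 y).
  by rewrite /edge /= map_tuple2.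
apply: sat_embeddings => //.
- apply: (@models_pullback _ M e1); last exact: models_completion.
    by move=> x y /edgeM0.
  by constructor; exact: v0 x0.
- apply/digraph_embeddingP; split=> [x y /eqE|x y].
    by rewrite !preK => /e1I.
  by rewrite edgeM0 -!preK edgeE.
Qed.


(** * Free amalgamation, realized in the monster model *)

Lemma finite_conjunction L (W U : Type) (A : set W) (h : W -> formula L U) :
  finite_set A ->
  exists g : formula L U, forall (M : structure L) (v : U -> M),
    sat g v <-> forall x, A x -> sat (h x) v.
Proof.
elim/Peq: W => W in A h *; move=> /finite_seqP[s ->].
elim: s => [|x s [g gE]]; first by exists (Imp Bot Bot) => M v; split=> /= [_ x|_].
exists (Not (Imp g (Not (h x)))) => M v /=; rewrite gE /=; split=> [H y|H].
  rewrite inE => /orP[/eqP ->|ys]; apply: contrapT => nx; apply: H.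
    by move=> _ /nx.
  by move=> /(_ _ ys)/nx.
by apply=> [y ys|]; apply: H; rewrite inE ?ys ?orbT ?eqxx.
Qed.

(* The points of [B] occur in both copies of [M], which saves a quotient; their
   second occurrences are junk. The first projection is a homomorphism to [M],
   so no directed cycle is created. *)
Definition free_double (M : structure digraph_language) (B : set M) :
    structure digraph_language :=
  @Structure digraph_language (M * bool)%type (fun _ (t : 2.-tuple (M * bool)) =>
    let u := tnth t ord0 in let v := tnth t ord_max in
    edge u.1 v.1 /\ [\/ u.2 = v.2, B u.1 | B v.1]).

Lemma edge_free_double (M : structure digraph_language) (B : set M)
    (u v : free_double B) :
  edge u v <-> edge u.1 v.1 /\ [\/ u.2 = v.2, B u.1 | B v.1].
Proof. by []. Qed.

Definition copair (A B C : Type) (f : A -> C) (g : B -> C) (z : A + B) : C :=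
  match z with inl x => f x | inr y => g y end.

Lemma comp_copair (A B C D : Type) (h : C -> D) (f : A -> C) (g : B -> C) :
  h \o copair f g = copair (h \o f) (h \o g).
Proof. by apply/funext => -[]. Qed.

(** Solvability of a finite part of the type of [d] over [C] is a formula about its parameters; it
    holds in [N], hence in [MM]. Saturation does the rest. *)
Lemma realize_in_extension (MM : monster T) (C : set MM) m
    (N : structure digraph_language) (e : MM -> N) (d : 'I_m -> N) :
  small (mon_card MM) C -> models N T -> embedding e ->
  exists c : 'I_m -> MM, forall f : pformula MM 'I_m, over C f ->
    (holds f c <-> sat (pf_body f) (copair d (e \o pf_param f))).
Proof.
move=> smC hN he; have hM := mon_models MM.
pose p : set (pformula MM 'I_m) :=
  [set f | over C f /\ sat (pf_body f) (copair d (e \o pf_param f))].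
have pC : complete_type C p.
  split=> [f []//|q qp finq|f fC].
    (* Parameters become variables indexed by [MM] itself, read through [id] in [MM] and through [e]
       in [N]. *)
    pose h (f : pformula MM 'I_m) : formula digraph_language ('I_m + MM) :=
      rename (copair inl (inr \o pf_param f)) (pf_body f).
    have [g gE] := finite_conjunction h finq.
    have [g' g'E] := exists_formula g.
    have /g'E[c /gE cq] : sat g' (id : MM -> MM).
      apply/(sat_embedding g' id hM hN he)/g'E; exists d; apply/gE => f /qp[_ fd].
      apply/sat_rename; move: fd; congr sat.
      by apply/funext => -[].
    exists c => f /cq/sat_rename; congr sat.
    by apply/funext => -[].
  by have [fd|nfd] := pselect (sat (pf_body f) (copair d (e \o pf_param f)));
    [left|right].
have [c cp] := mon_saturated smC pC.
exists c => f fC; split=> [fc|fd]; last exact: cp.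
by apply: contrapT => nfd; exact: (cp (pnot f)).
Qed.

(** Glue two copies of [MM] freely over [B], with [C] in the first, and move the coordinates of [c]
    outside [B] to the second. This keeps the type over [B]; the new type over [C] is then realized
    in [MM]. *)
Lemma free_realization (MM : monster T) (B C : set MM) m (c : 'I_m -> MM) :
  small (mon_card MM) C -> B `<=` C ->
  exists c' : 'I_m -> MM,
    [/\ forall f, over B f -> (holds f c <-> holds f c'),
        forall k, B (c k) -> c' k = c k,
        forall k, ~ B (c k) -> ~ C (c' k)
      & forall k x, C x -> ~ B x -> ~ B (c k) ->
          ~ edge (c' k) x /\ ~ edge x (c' k)].
Proof.
move=> smC BC; have hM := mon_models MM.
have [_ /(_ (free_double B)) hN _] := hT.
have [|N [{}hN [g /digraph_embeddingP[gI gE]]]] := hN.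
  apply: (@models_pullback (free_double B) MM fst); last exact: models_completion.
    by move=> x y /edge_free_double[].
  by case: hM => [[x0] _]; constructor; exact: (x0, false).
pose e (x : MM) : N := g (x, false).
(* The copy used for [x]; points of [B] take their first occurrence. *)
pose s (x : MM) : bool := ~~ `[< B x >].
have sB x : B x -> s x = false by move=> Bx; rewrite /s asboolT.
have snB x : ~ B x -> s x = true by move=> Bx; rewrite /s asboolF.
pose d k : N := g (c k, s (c k)).
have he : embedding e.
  apply/digraph_embeddingP; split=> [x y /gI[]//|x y].
  rewrite -gE edge_free_double /=; split=> [|[]//]; split=> //; exact: Or31.
have [c' c'E] := realize_in_extension d smC hN he.
pose eqf k (x : MM) : pformula MM 'I_m :=
  @PFormula _ MM _ 1 (Eq (inl k) (inr ord0)) (fun=> x).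
pose outf k (x : MM) : pformula MM 'I_m :=
  @PFormula _ MM _ 1 (Edge (inl k) (inr ord0)) (fun=> x).
pose inf k (x : MM) : pformula MM 'I_m :=
  @PFormula _ MM _ 1 (Edge (inr ord0) (inl k)) (fun=> x).
exists c'; split.
- move=> f fB; rewrite c'E; last by move=> i; exact/BC/fB.
  have -> : holds f c <-> sat (pf_body f) (copair (e \o c) (e \o pf_param f)).
    by rewrite -comp_copair; exact: (sat_embedding _ _ hM hN he).
  pose z := copair c (pf_param f).
  have -> : copair (e \o c) (e \o pf_param f) = (fun i => g (z i, false)).
    by apply/funext => -[].
  have -> : copair d (e \o pf_param f) = (fun i => g (z i, s (z i))).
    by apply/funext => -[i|i] //=; rewrite (sB _ (fB i)).
  (* Passing from [(x, false)] to [(x, s x)] changes no edge: points of [B] are joined to both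
     copies, and two points outside [B] move together. *)
  apply: quantifier_elimination => // i j.
    by split=> /gI[->].
  rewrite -!gE !edge_free_double /=; split=> -[ij _]; split=> //; last exact: Or31.
  have [Bi|Bi] := pselect (B (z i)); first exact: Or32.
  have [Bj|Bj] := pselect (B (z j)); first exact: Or33.
  by apply: Or31; rewrite !snB.
- move=> k Bk; apply/(c'E (eqf k (c k))); first by move=> i; exact: BC.
  by rewrite /= /d sB.
- move=> k Bk Ck; have /(c'E (eqf k (c' k))) : over C (eqf k (c' k)) by [].
  by move=> /iffLR/(_ erefl) /=; rewrite /d snB // => /gI[].
- move=> k x Cx Bx Bk; split=> H.
    have /(c'E (outf k x)) : over C (outf k x) by [].
    rewrite /holds /= !map_tuple2 => /iffLR/(_ H) /gE/edge_free_double[_] /=.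
    by rewrite snB // => -[].
  have /(c'E (inf k x)) : over C (inf k x) by [].
  rewrite /holds /= !map_tuple2 => /iffLR/(_ H) /gE/edge_free_double[_] /=.
  by rewrite snB // => -[].
Qed.

Lemma infinite_mon_card (MM : monster T) : infinite_set [set: mon_card MM].
Proof.
move=> fin; apply: (@mon_formulas _ _ MM).
apply: card_le_trans (finite_set_countable fin) _.
by apply/card_leTE; exists (fun n => Eq n n); split=> // x y [].
Qed.

(** * Indiscernible sequences and shredding *)

Lemma indiscernible_const L (M : structure L) (I : cardinal) (J : Type)
    (A : set M) (b : I -> J -> M) (x : M) (i i' : I) (j : J) :
  indiscernible setT A b -> A x -> b i j = x -> b i' j = x.
Proof.
move=> ind Ax.
have homo1 (r : I) : {homo (fun _ : 'I_1 => r) : u v / (u < v)%O}.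
  by move=> u v; rewrite (ord1 u) (ord1 v) ltxx.
have := ind 1 (fun=> i) (fun=> i')
  (@PFormula _ M _ 1 (Eq (inl (ord0, j)) (inr ord0)) (fun=> x)).
by case=> // h _ /h.
Qed.

Lemma homo_pair (I : cardinal) (r r' : I) : (r < r')%O ->
  {homo (fun u : 'I_2 => if u == ord0 then r else r') : u v / (u < v)%O}.
Proof. by move=> rr' [[|[|u]] hu] [[|[|v]] hv]. Qed.

(** If [x l] occurs as [b r j0], then for [i] above [r] the equation [b r j0 = b i j] is a formula
    without parameters about two terms, so its truth does not depend on [i]. Finitely many points
    give finitely many thresholds. *)
Lemma indiscernible_eventually_const L (M : structure L) (I : cardinal)
    (J : Type) (A : set M) (b : I -> J -> M) n (x : 'I_n -> M) :
  inhabited I -> indiscernible setT A b ->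
  exists a : I, forall l i i' j, (a <= i)%O -> (a <= i')%O ->
    b i j = x l -> b i' j = x l.
Proof.
move=> [i0] ind; elim: n x => [|n IHn] x; first by exists i0 => -[].
have [a aP] := IHn (x \o lift ord_max).
suff [a' a'P] : exists a' : I, forall i i' j, (a' <= i)%O -> (a' <= i')%O ->
    b i j = x ord_max -> b i' j = x ord_max.
  exists (Order.max a a') => l i i' j; rewrite !ge_max => /andP[ai a'i].
  move=> /andP[ai' a'i']; case: (unliftP ord_max l) => [l' ->|->].
    exact: aP.
  exact: a'P.
have [[r [j0 rj0]]|nox] := pselect (exists r j, b r j = x ord_max); last first.
  by exists i0 => i i' j _ _ ij; case: nox; exists i, j.
have [[r' rr']|rmax] := pselect (exists r' : I, (r < r')%O); last first.
  exists r => i i' j ri ri' <-; congr b; apply/eqP.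
  have rE k : (r <= k)%O -> k = r.
    by rewrite le_eqVlt => /orP[/eqP //|rk]; case: rmax; exists k.
  by rewrite (rE i ri) (rE i' ri').
(* Starting at [r'] and not at [r] keeps both pairs of indices strictly increasing. *)
exists r' => i i' j r'i r'i'; rewrite -rj0.
have := ind 2 _ _ (@PFormula _ M _ 0 (Eq (inl (ord0, j0)) (inl (ord_max, j)))
  (fun i => x (widen_ord (leq0n _) i))) _ _ _
  (homo_pair (lt_le_trans rr' r'i)) (homo_pair (lt_le_trans rr' r'i')).
by case=> [[]//|//|//|/= h _ /esym/h].
Qed.

Definition eq_formula (M : structure digraph_language) m (k : 'I_m) (x : M) :
    pformula M 'I_m :=
  @PFormula _ M 'I_m 1 (Eq (inl k) (inr ord0)) (fun=> x).

(** Only equalities and edges between two variables matter. A parameter outside [A] is a coordinate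
    of [c]; it equals no entry of [b], and it has edges only to entries in [D], which are constant
    on [S]. *)
Lemma indiscernible_free (MM : monster T) (I : cardinal) (J : Type)
    (A C D : set MM) (S : set I) (b : I -> J -> MM) m (c : 'I_m -> MM) :
  A `<=` C -> indiscernible setT A b -> (forall i j, C (b i j)) ->
  (forall i i' j, S i -> S i' -> D (b i j) -> b i' j = b i j) ->
  (forall k, ~ A (c k) -> ~ C (c k)) ->
  (forall k x, C x -> ~ D x -> ~ A (c k) -> ~ edge (c k) x /\ ~ edge x (c k)) ->
  indiscernible S (A `|` range c) b.
Proof.
move=> AC ind bC bD cC cE n s t f fA sS tS shomo thomo.
have hM := mon_models MM.
have fAc u : ~ A (pf_param f u) -> exists k, c k = pf_param f u.
  by move=> nA; have [//|[k _ <-]] := fA u; exists k.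
have indA (x : MM) (g : formula digraph_language ('I_n * J + 'I_1)) : A x ->
    sat g (copair (fun z => b (s z.1) z.2) (fun=> x)) <->
    sat g (copair (fun z => b (t z.1) z.2) (fun=> x)).
  by move=> Ax; exact: (ind n s t (@PFormula _ MM _ 1 g (fun=> x))).
have ind0 (g : formula digraph_language ('I_n * J)) :
    sat g (fun z => b (s z.1) z.2) <-> sat g (fun z => b (t z.1) z.2).
  have := ind n s t (@PFormula _ MM _ 0 (rename inl g)
    (fun i => False_rect MM (notF (ltn_ord i)))) _ _ _ shomo thomo.
  by rewrite /holds /= !sat_rename; apply=> // -[].
have bcE u z : ~ A (pf_param f u) ->
    (edge (pf_param f u) (b (s z.1) z.2) <-> edge (pf_param f u) (b (t z.1) z.2)) /\
    (edge (b (s z.1) z.2) (pf_param f u) <-> edge (b (t z.1) z.2) (pf_param f u)).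
  move=> nA; have [k ck] := fAc u nA; rewrite -ck; rewrite -ck in nA.
  have [Ds|Ds] := pselect (D (b (s z.1) z.2)); first by rewrite (bD _ (t z.1) _ _ _ Ds).
  have [Dt|Dt] := pselect (D (b (t z.1) z.2)); first by rewrite (bD _ (s z.1) _ _ _ Dt).
  have [? ?] := cE k _ (bC _ _) Ds nA; have [? ?] := cE k _ (bC _ _) Dt nA.
  by split; split.
have bceq u z i : ~ A (pf_param f u) -> b i z <> pf_param f u.
  move=> nA; have [k ck] := fAc u nA; rewrite -ck; rewrite -ck in nA => ckb.
  by apply: (cC k nA); rewrite -ckb.
apply: quantifier_elimination => //.
- move=> [z|u] [z'|u'] //.
  + exact: (ind0 (Eq z z')).
  + have [Au|nA] := pselect (A (pf_param f u')).
      exact: (indA _ (Eq (inl z) (inr ord0)) Au).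
    by split=> /bceq.
  + have [Au|nA] := pselect (A (pf_param f u)).
      exact: (indA _ (Eq (inr ord0) (inl z')) Au).
    by split=> /esym/bceq.
- move=> [z|u] [z'|u'] //.
  + by have := ind0 (Edge z z'); rewrite /= !map_tuple2.
  + have [Au|nA] := pselect (A (pf_param f u')).
      by have := indA _ (Edge (inl z) (inr ord0)) Au; rewrite /= !map_tuple2.
    by have [] := bcE u' z nA.
  + have [Au|nA] := pselect (A (pf_param f u)).
      by have := indA _ (Edge (inr ord0) (inl z')) Au; rewrite /= !map_tuple2.
    by have [] := bcE u z' nA.
Qed.

(** The hypothesis on [eq_formula] says that coordinates of [p] in [B] are already in [A]. Two free
    replacements, over [B] and then over [D], give a solution of [f] that refutes the witness
    [b]. *)
Lemma not_shreds_built_in (MM : monster T) (A B : set MM) m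
    (p : set (pformula MM 'I_m)) :
  small (mon_card MM) B -> complete_type B p ->
  (forall k x, p (eq_formula k x) -> A x) ->
  ~ shreds_built_in A B p.
Proof.
move=> smB pB pA [AB [I [[Ibig _] [f [pf [J [b [_ bB [ind nwit]]]]]]]]].
have I0 : inhabited I.
  apply: contrapT => noI; apply: Ibig; apply/card_leTE.
  exists (fun i => False_rect _ (noI (inhabits i))).
  by split=> [i|i]; case: noI.
have [_ _ ptot] := pB.
have [c0 c0p] := mon_saturated smB pB.
have c0A k : B (c0 k) -> A (c0 k).
  move=> Bk; apply: (pA k).
  have [//|/c0p pn] := ptot (eq_formula k (c0 k)) (fun=> Bk).
  by case: pn.
pose D := A `|` range (pf_param f); pose C := B `|` range (pf_param f).
have smC : small (mon_card MM) C by apply: smallU_range => //; exact: infinite_mon_card.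
have DC : D `<=` C by move=> x [/AB|]; [left|right].
(* [f] survives because the type [p] over [B] implies it; now the tuple meets [C] only inside
   [A]. *)
have [c1 [c1E c1B c1C _]] := free_realization c0 smC (@subsetUl _ _ _).
have fc1 : holds f c1 by apply: pf => g pg; apply/c1E; [case: pB => + _ _; exact|exact: c0p].
have c1A k : C (c1 k) -> A (c1 k).
  have [Bk|nB] := pselect (B (c0 k)); first by rewrite c1B // => _; exact: c0A.
  by move/(c1C _ nB).
(* [f] survives because its parameters lie in [D]; coordinates outside [A] lose all edges to [C]
   outside [D]. *)
have [c2 [c2E c2D c2C c2edge]] := free_realization c1 smC DC.
have c2A k : ~ A (c2 k) -> ~ D (c1 k).
  by move=> nA Dk; apply: nA; rewrite c2D //; exact/c1A/DC.
have [a aP] := indiscernible_eventually_const (pf_param f) I0 ind.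
apply: (nwit a c2); first by apply/c2E => // i; right; exists i.
apply: (@indiscernible_free _ _ _ _ C D) => //.
- by move=> x /AB; left.
- by move=> i j; left.
(* Entries in [A] are constant throughout, entries among the parameters of [f] from [a] on. *)
- move=> i i' j ai ai' [Ab|[l _ bl]]; first exact: indiscernible_const ind Ab erefl.
  by rewrite -bl; exact: aP ai ai' _.
- by move=> k /c2A/c2C.
- by move=> k x Cx Dx /c2A; exact: c2edge.
Qed.

(** There are finitely many coordinates, so some stage [i] contains all those that [p] ever equates
    with an element of a model; the next step cannot shred. *)
Lemma no_shred_chain m : ~ shred_chain T m aleph0.
Proof.
move=> [MM [N [NK [p [[Nsm _] Nmono [_ NKE] [pNK pfin ptot] shr]]]]].
pose alg k (i : nat) := exists2 x, N i x & p (eq_formula k x).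
(* [r k] is a stage naming coordinate [k], with the junk value 0 if there is none. *)
have /choice[r rP] : forall k, exists i, (exists i', alg k i') -> alg k i.
  move=> k; have [[i ki]|nok] := pselect (exists i, alg k i); last by exists 0.
  by exists i.
pose i := \max_k r k.
have si : ord_succ (i : aleph0) i.+1.
  split=> [|k]; first exact: ltnSn.
  by apply/negP => /andP[]; rewrite !ltEnat /= => ik; rewrite ltnS leqNgt ik.
apply: (not_shreds_built_in _ _ _ (shr _ _ si)).
- by case: (Nsm i.+1).
- have NNK : N i.+1 `<=` NK by rewrite NKE => x Nx; exists i.+1.
  split=> [f []//|q qp|f fN].
    by apply: pfin => f /qp[].
  have [pf|pf] := ptot f (fun l => NNK _ (fN l)); by [left|right].
- move=> k x [px xN].
  have [y Ny py] : alg k (r k) by apply: rP; exists i.+1, x => //; exact: xN ord0.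
  have Niy : N i y by apply: Nmono Ny; rewrite leEnat; exact: leq_bigmax.
  (* Consistency of [p] identifies [x] with [y], which lies in [N i]. *)
  have pxy : [set eq_formula k x; eq_formula k y] `<=` p by move=> f [->|->].
  have [c cP] := pfin _ pxy (finite_set2 _ _).
  have cx : c k = x by exact: (cP _ (or_introl erefl)).
  have cy : c k = y by exact: (cP _ (or_intror erefl)).
  by rewrite -cx cy.
Qed.

End ModelCompletion.

(** * The value of the supremum *)

Lemma infinite_regular_aleph0 : infinite_regular aleph0.
Proof.
split=> [|C Ccof]; first exact: infinite_nat.
apply/infiniteP => /finite_seqP[s sE].
have [y Cy] := Ccof (\max_(x <- s) x).+1.
rewrite sE in Cy; rewrite leEnat leqNgt => /negP; apply.
by rewrite ltnS; exact: leq_bigmax_seq.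
Qed.

Theorem proposition4p4 (T3 : theory digraph_language) (hT3 : model_completion T3 digraph3) :
  is_kappa_shred T3 (Some aleph0).
Proof.
split=> [[K|] [m]|k' ub].
- by move=> [_ _]; apply=> //; [exact: infinite_regular_aleph0|exact: no_shred_chain].
- by move=> /(_ _ infinite_regular_aleph0)/(no_shred_chain hT3).
(* The value is attained already at [m = 0], since regular cardinals are infinite here. *)
- apply: ub; exists 0; split=> [||K [Kinf _] _].
  + exact: infinite_regular_aleph0.
  + exact: no_shred_chain.
  + exact/infiniteP.
Qed.
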